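(* Let $\mathbb{D}=\langle (E_1,t_1),\ldots,(E_n,t_n)\rangle$ be an event sequence with $t_1<\cdots<t_n$, let $\alpha$ be an $N$-node serial episode and let $T_X$ be an expiry-time threshold. Let $H_{nX}=\{h_1^{nX},h_2^{nX},\ldots,h_{f'}^{nX}\}$ be the sequence of occurrences of $\alpha$ tracked by the NO-X algorithm run on $\mathbb{D}$ with threshold $T_X$ (i.e. the occurrences for which the frequency is incremented). Then $H_{nX}$ is a maximal non-overlapped sequence of occurrences satisfying the expiry-time constraint $T_X$: its members are pairwise non-overlapped occurrences of $\alpha$, each of span at most $T_X$, and $|H_{nX}|\ge |H'|$ for every set $H'$ of pairwise non-overlapped occurrences of $\alpha$ in $\mathbb{D}$ each of span at most $T_X$.
   Context: An event sequence is $\mathbb{D}=\langle (E_1,t_1),\ldots,(E_n,t_n)\rangle$, where each event-type $E_i$ belongs to a finite alphabet and each $t_i$ is a positive integer. An $N$-node serial episode is a sequence of event-types $\alpha=(\alpha[1]\to\cdots\to\alpha[N])$ with nodes $v_1,\ldots,v_N$. An occurrence of $\alpha$ in $\mathbb{D}$ is a map $h:\{v_1,\ldots,v_N\}\to\{1,\ldots,n\}$ with $E_{h(v_i)}=\alpha[i]$ for all $i$ and $t_{h(v_1)}<\cdots<t_{h(v_N)}$. Its span is $t_{h(v_N)}-t_{h(v_1)}$; it satisfies the expiry-time constraint $T_X$ if its span does not exceed $T_X$. Two occurrences $h_1,h_2$ are non-overlapped if $t_{h_1(v_N)}<t_{h_2(v_1)}$ or $t_{h_2(v_N)}<t_{h_1(v_1)}$.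 Automata. An automaton for $\alpha$ has states $0,1,\ldots,N$; in state $j<N$ it waits for an event of type $\alpha[j+1]$, and on accepting such an event it moves to state $j+1$. State $0$ is the start state and state $N$ the final state. An automaton reaching state $N$ has tracked the occurrence consisting of the $N$ events it accepted. The NO-X algorithm. Initially there is one automaton, in state $0$, and the frequency is $0$. The events are processed in time order. When event $(E_l,t_l)$ is processed: (1) every automaton present before this event and waiting for event-type $E_l$ accepts it and moves to its next state (each automaton makes at most one transition per event); whenever an automaton leaves state $0$, a new automaton is placed in state $0$ (it does not process the current event); (2) if, as a result, an automaton has moved into a state $j$ with $0<j<N$ in which an automaton initialized earlier is still present (that one did not move on this event), the earlier-initialized automaton is removed; (3) if an automaton has reached state $N$, it is removed, and if the occurrence it tracked has span at most $T_X$, the frequency is incremented by $1$ and all automata for $\alpha$ are removed and replaced by a single automaton in state $0$ (which starts processing from the next event); if the span exceeds $T_X$, only the automaton that reached state $N$ is removed. *)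

(* Defs.v *)
From mathcomp Require Import all_boot.

Set Implicit Arguments.
Unset Strict Implicit.
Unset Printing Implicit Defensive.

(* An event sequence over the alphabet [A] is an [n.-tuple (A * nat)], indexed
   from 0.  Occurrences of an [N]-node episode are finite functions
   ['I_N -> 'I_n] with [N = m.+1], so that the first node [ord0] and the last
   node [ord_max] exist. *)

Definition etype (A : Type) n (D : n.-tuple (A * nat)) (i : 'I_n) : A :=
  (tnth D i).1.

Definition etime (A : Type) n (D : n.-tuple (A * nat)) (i : 'I_n) : nat :=
  (tnth D i).2.

Definition occurrence (A : Type) n m (D : n.-tuple (A * nat))
    (alpha : m.+1.-tuple A) (h : {ffun 'I_m.+1 -> 'I_n}) : Prop :=
  (forall i, etype D (h i) = tnth alpha i) /\
  (forall i j : 'I_m.+1, i < j -> etime D (h i) < etime D (h j)).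

(* The truncated subtraction is exact on occurrences. *)
Definition span (A : Type) n m (D : n.-tuple (A * nat))
    (h : {ffun 'I_m.+1 -> 'I_n}) : nat :=
  etime D (h ord_max) - etime D (h ord0).

Definition non_overlapped (A : Type) n m (D : n.-tuple (A * nat))
    (h1 h2 : {ffun 'I_m.+1 -> 'I_n}) : bool :=
  (etime D (h1 ord_max) < etime D (h2 ord0)) ||
  (etime D (h2 ord_max) < etime D (h1 ord0)).

(* [accepted a] lists the events accepted by [a], oldest first; its length is
   the state of [a].  [init a] is the number of events processed when [a] was
   placed in state 0: [a] was initialized earlier than [b] iff
   [init a < init b]. *)
Record automaton n := Automaton { init : nat; accepted : seq 'I_n }.

Definition state n (a : automaton n) : nat := size (accepted a).

(* [onth] is [None] out of range, so an automaton in the final state waits for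
   nothing. *)
Definition waits (A : eqType) n N (alpha : N.-tuple A) (e : A)
    (a : automaton n) : bool :=
  onth alpha (state a) == Some e.

Definition accept n (l : 'I_n) (a : automaton n) : automaton n :=
  Automaton (init a) (rcons (accepted a) l).

(* Used only when [size s = m.+1]; the default [l] is then irrelevant. *)
Definition tracked n m (l : 'I_n) (s : seq 'I_n) : {ffun 'I_m.+1 -> 'I_n} :=
  [ffun i : 'I_m.+1 => nth l s i].

(* The automata present, and the occurrences for which the frequency has been
   incremented, in order; the frequency is [size (found c)]. *)
Record config n m := Config {
  automata : seq (automaton n);
  found : seq {ffun 'I_m.+1 -> 'I_n}
}.

Definition nox_init n m : config n m := Config [:: Automaton 0 [::]] [::].

(* No two automata present are in the same state, so at most one reaches the
   final state on a given event and [hits] has at most one element. *)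
Definition nox_step (A : eqType) n m (D : n.-tuple (A * nat))
    (alpha : m.+1.-tuple A) (TX : nat) (c : config n m) (l : 'I_n) :
    config n m :=
  let w := waits alpha (etype D l) in
  let moved := [seq accept l a | a <- automata c & w a] in
  let unmoved := [seq a <- automata c | ~~ w a] in
  let fresh := [seq Automaton l.+1 [::] |
                 a <- automata c & w a && (state a == 0)] in
  let superseded a := has (fun b : automaton n =>
    [&& 0 < state b < m.+1, state a == state b & init a < init b]) moved in
  let kept := [seq a <- unmoved | ~~ superseded a] in
  let running := [seq a <- moved | state a != m.+1] in
  let completed := [seq tracked m l (accepted a) |
                     a <- moved & state a == m.+1] in
  let hits := [seq h <- completed | span D h <= TX] in
  if hits is h :: _ then
    Config [:: Automaton l.+1 [::]] (rcons (found c) h)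
  else Config (kept ++ running ++ fresh) (found c).

Definition nox (A : eqType) n m (D : n.-tuple (A * nat))
    (alpha : m.+1.-tuple A) (TX : nat) : seq {ffun 'I_m.+1 -> 'I_n} :=
  found (foldl (nox_step D alpha TX) (nox_init n m) (enum 'I_n)).

(* Main.v *)
(* Let [s] be the position of the last reset.  Among the automata, the one that
   started latest dominates: any partial occurrence tracked from [s] on that can
   still meet the expiry time is matched, at least as far, by an automaton that
   started no earlier.  Hence the algorithm counts an occurrence as soon as an
   occurrence of span at most [TX] is completed after [s].  Two non-overlapped
   occurrences that start between two consecutive resets would force the first
   of them to end before the second reset, so every set of non-overlapped
   occurrences has at most one member per counted occurrence. *)
Require Import Defs.
From HB Require Import structures.
From mathcomp Require Import all_boot.

Set Implicit Arguments.
Unset Strict Implicit.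
Unset Printing Implicit Defensive.

(** * Prefixes, and decidable equality of automata *)

Lemma prefix_rconsE (T : eqType) (s t : seq T) (x : T) :
  prefix (rcons s x) t = prefix s t && (onth t (size s) == Some x).
Proof.
elim: s t => [|y s IHs] [|z t] //=; first by rewrite prefix0s andbT eq_sym.
by rewrite IHs andbA.
Qed.

(** The encoding as pairs gives [automaton n] the equality that membership [a \in automata c]
    requires. *)
Definition automaton_pair n (a : automaton n) := (init a, accepted a).
Definition pair_automaton n (p : nat * seq 'I_n) := Automaton p.1 p.2.

Lemma automaton_pairK n : cancel (@automaton_pair n) (@pair_automaton n).
Proof. by case. Qed.

HB.instance Definition _ n :=
  Equality.copy (automaton n) (can_type (@automaton_pairK n)).

Section NoX.

Variables (A : eqType) (n m : nat) (D : n.-tuple (A * nat)).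
Variables (alpha : m.+1.-tuple A) (TX : nat).
Hypothesis t_incr : forall i j : 'I_n, i < j -> etime D i < etime D j.

Implicit Types (a b : automaton n) (p q : seq 'I_n) (x y l : 'I_n).
Implicit Types (h : {ffun 'I_m.+1 -> 'I_n}) (c : config n m).

(** * Positions in place of times, and partial occurrences *)

Lemma etime_lt x y : (etime D x < etime D y) = (x < y).
Proof.
case: (ltngtP x y) => [/t_incr //|/t_incr lt_yx|/val_inj ->].
  by apply/negbTE; rewrite -leqNgt ltnW.
by rewrite ltnn.
Qed.

Lemma etime_le x y : (etime D x <= etime D y) = (x <= y).
Proof. by rewrite leqNgt etime_lt -leqNgt. Qed.

(** A partial occurrence, in the list form of [accepted]. In use, [s] is the position of the last
    reset and [k] the number of events processed. *)
Definition embedding (s k : nat) p :=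
  [&& pairwise (fun x y => x < y) p, all (fun x : 'I_n => s <= x < k) p
    & prefix (map (etype D) p) alpha].

Definition valid h := occurrence D alpha h /\ span D h <= TX.

Lemma embedding_size s k p : embedding s k p -> size p <= m.+1.
Proof.
by case/and3P=> _ _ /size_prefix; rewrite size_map size_tuple.
Qed.

Lemma embedding_nil s k : embedding s k [::].
Proof. exact: prefix0s. Qed.

Lemma embedding_mem s k p x : embedding s k p -> x \in p -> s <= x < k.
Proof. by case/and3P=> _ /allP ap _ /ap. Qed.

(** Extending an embedding by [l] mirrors a transition: the last conjunct is the test made by
    [waits]. *)
Lemma embedding_rcons s l p :
  embedding s l.+1 (rcons p l) =
  [&& s <= l, embedding s l p & onth alpha (size p) == Some (etype D l)].
Proof.
rewrite /embedding map_rcons prefix_rconsE size_map pairwise_rcons all_rcons.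
rewrite ltnSn andbT.
(* Monotonicity up to the last element [l] supplies the bound [x < l], so [p] lies below [l] and not
   merely below [l.+1]. *)
have ->: all (fun x : 'I_n => s <= x < l) p =
    all (fun x : 'I_n => x < l) p && all (fun x : 'I_n => s <= x < l.+1) p.
  rewrite -all_predI; apply: eq_all => x /=.
  by case: (ltnP x l) => [/ltnW lt_xl|]; rewrite ?andbF // ltnS lt_xl.
by case: (pairwise _ p); case: (all _ p); case: (all _ p); case: (s <= l);
   case: (prefix _ _); rewrite ?andbF.
Qed.

(** Positions increase, so the newest one, [l], can only be the last element. *)
Lemma embeddingSP s l p : embedding s l.+1 p ->
  embedding s l p \/
  exists q, [/\ p = rcons q l, s <= l, embedding s l q
              & onth alpha (size q) = Some (etype D l)].
Proof.
case/lastP: p => [|p x] ep; first by left.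
have /andP[sx] : s <= x < l.+1.
  by apply: embedding_mem ep _; rewrite mem_rcons mem_head.
rewrite ltnS leq_eqVlt => /predU1P[/val_inj ex|lt_xl].
  move: ep; rewrite ex embedding_rcons => /and3P[sl ep /eqP op].
  by right; exists p.
left; move: ep; rewrite /embedding pairwise_rcons =>
  /and3P[/andP[px pp] ap pref].
rewrite px pp pref all_rcons sx lt_xl /= andbT.
move: ap; rewrite all_rcons => /andP[_ /allP ap].
apply/allP=> y yp; have /andP[-> _] := ap y yp.
exact: ltn_trans (allP px y yp) lt_xl.
Qed.

Lemma embeddingS s l p : embedding s l p -> embedding s l.+1 p.
Proof.
case/and3P=> sp ap pp; apply/and3P; split=> //.
by apply: sub_all ap => x /andP[-> /ltnW].
Qed.

Definition trace h := [seq h i | i <- enum 'I_m.+1].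

Lemma traceE h : exists q,
  [/\ trace h = rcons q (h ord_max), size q = m
    & ohead (trace h) = Some (h ord0)].
Proof.
exists [seq h (widen_ord (leqnSn m) i) | i <- enum 'I_m].
rewrite size_map size_enum_ord; split=> //.
  by rewrite /trace enum_ordSr map_rcons -map_comp.
by rewrite /trace enum_ordSl.
Qed.

Lemma embedding_trace s k h : occurrence D alpha h ->
  s <= h ord0 -> h ord_max < k -> embedding s k (trace h).
Proof.
case=> type_h time_h s_h h_k; apply/and3P; split.
- rewrite pairwise_map; apply: (@sub_pairwise _ (fun i j : 'I_m.+1 => i < j)).
    by move=> i j /time_h; rewrite etime_lt.
  rewrite -(pairwise_map val ltn) val_enum_ord -sorted_pairwise.
    exact: iota_ltn_sorted.
  exact: ltn_trans.
- apply/allP=> _ /mapP[i _ ->].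
  have mono (j1 j2 : 'I_m.+1) : j1 <= j2 -> h j1 <= h j2.
    rewrite leq_eqVlt => /predU1P[/val_inj -> //|/time_h].
    by rewrite etime_lt => /ltnW.
  by rewrite (leq_trans s_h) ?mono // (leq_ltn_trans _ h_k) // mono // -ltnS.
- by rewrite /trace -map_comp (eq_map type_h) map_tnth_enum prefix_refl.
Qed.

Lemma tracked_occurrence s k l p : embedding s k p -> size p = m.+1 ->
  occurrence D alpha (tracked m l p).
Proof.
case/and3P=> /(pairwiseP l) sp _ pp size_p; split=> [i | i j lt_ij].
  rewrite ffunE (tnth_nth (etype D l)).
  rewrite -(nth_map l (etype D l)) ?size_p //.
  move: pp; rewrite prefixE size_map size_p => /eqP <-.
  by rewrite nth_take.
by rewrite !ffunE etime_lt sp ?inE ?size_p.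
Qed.

Lemma tracked_rcons_max l p : size p = m -> tracked m l (rcons p l) ord_max = l.
Proof. by move=> size_p; rewrite ffunE nth_rcons /= size_p ltnn eqxx. Qed.

Lemma tracked_cons0 l x p : tracked m l (x :: p) ord0 = x.
Proof. by rewrite ffunE. Qed.

(** * One step of the algorithm *)

(** The properties of a step without a counted occurrence on which the invariants rest. In
    [miss_keep], [b] is the superseding automaton before its move, hence the successor. *)
Record miss c l (L : seq (automaton n)) : Prop := Miss {
  miss_span a : a \in automata c -> waits alpha (etype D l) a -> state a = m ->
    TX < span D (tracked m l (rcons (accepted a) l));
  miss_sub a' : a' \in L ->
    [\/ a' \in automata c /\ ~~ waits alpha (etype D l) a',
        exists a, [/\ a \in automata c, waits alpha (etype D l) a,
                      state a <> m & a' = accept l a]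
      | (exists a, [/\ a \in automata c, waits alpha (etype D l) a
                     & state a = 0]) /\ a' = Automaton l.+1 [::]];
  miss_accept a : a \in automata c -> waits alpha (etype D l) a ->
    state a <> m -> accept l a \in L;
  miss_fresh a : a \in automata c -> waits alpha (etype D l) a ->
    state a = 0 -> Automaton l.+1 [::] \in L;
  miss_keep a : a \in automata c -> ~~ waits alpha (etype D l) a ->
    a \in L \/ exists b, [/\ b \in automata c, waits alpha (etype D l) b,
                             state b < m, state a = (state b).+1
                           & init a < init b]
}.

Variant step_spec c l : config n m -> Prop :=
| StepHit a of a \in automata c & waits alpha (etype D l) a & state a = m
    & span D (tracked m l (rcons (accepted a) l)) <= TX :
    step_spec c l (Config [:: Automaton l.+1 [::]]
                     (rcons (found c) (tracked m l (rcons (accepted a) l))))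
| StepMiss L of miss c l L : step_spec c l (Config L (found c)).

Lemma state_accept l a : state (accept l a) = (state a).+1.
Proof. by rewrite /state size_rcons. Qed.

Lemma nox_stepP c l : step_spec c l (nox_step D alpha TX c l).
Proof.
rewrite /nox_step.
set w := waits alpha (etype D l).
set moved := [seq accept l a | a <- automata c & w a].
have movedP b : reflect (exists a, [/\ a \in automata c, w a & b = accept l a])
    (b \in moved).
  apply: (iffP mapP) => [[a]|[a [ac wa ->]]].
    by rewrite mem_filter => /andP[wa ac] ->; exists a.
  by exists a; rewrite // mem_filter wa.
set hits := [seq h <- _ | span D h <= TX].
have hitsP h : reflect (exists a, [/\ a \in automata c, w a, state a = m,
      h = tracked m l (rcons (accepted a) l) & span D h <= TX]) (h \in hits).
  rewrite mem_filter; apply: (iffP andP) => [[sh /mapP[b]]|[a [ac wa sa -> ->]]].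
    rewrite mem_filter => /andP[sb /movedP[a [ac wa eb]]] eh.
    exists a; split=> //; last by rewrite eh eb.
    by move: sb; rewrite eb state_accept eqSS => /eqP.
  split=> //; apply/mapP; exists (accept l a) => //.
  by rewrite mem_filter state_accept sa eqxx /=; apply/movedP; exists a.
case: hits hitsP => [|h hs] hitsP; last first.
  have /hitsP[a [ac wa sa -> sh]] : h \in h :: hs by apply: mem_head.
  exact: StepHit.
apply: StepMiss; split.
- move=> a ac wa sa; rewrite ltnNge; apply/negP=> sh.
  suff: tracked m l (rcons (accepted a) l) \in [::] by [].
  by apply/hitsP; exists a.
- move=> a'; rewrite !mem_cat !mem_filter => /or3P[].
  + by case/and3P=> _ wa' ac'; constructor 1.
  + case/andP=> sa' /movedP[a [ac wa ea']]; constructor 2; exists a.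
    split=> //; move: sa'; rewrite ea' state_accept eqSS.
    by move/eqP.
  + case/mapP=> a; rewrite mem_filter => /andP[/andP[wa /eqP sa] ac] ->.
    by constructor 3; split=> //; exists a; rewrite -/w.
- move=> a ac wa sa; rewrite !mem_cat; apply/or3P; constructor 2.
  rewrite mem_filter state_accept eqSS; apply/andP; split; first exact/eqP.
  by apply/movedP; exists a.
- move=> a ac wa sa; rewrite !mem_cat; apply/or3P; constructor 3.
  by apply/mapP; exists a; rewrite // mem_filter [w a]wa sa ac.
- move=> a ac; rewrite -/w => wa.
  case: (boolP (has (fun b : automaton n =>
    [&& 0 < state b < m.+1, state a == state b & init a < init b]) moved)).
    case/hasP=> _ /movedP[b [bc wb ->]]; rewrite state_accept ltnS.
    by case/and3P=> sb /eqP sab iab; right; exists b.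
  by move=> ns; left; rewrite mem_cat !mem_filter ns wa ac.
Qed.

(** * Automata alive since the last reset *)

Record tracking s k (L : seq (automaton n)) : Prop := Tracking {
  tracking_embedding : forall a, a \in L -> embedding s k (accepted a);
  tracking_state : forall a, a \in L -> state a <= m;
  tracking_init : forall a, a \in L -> init a <= k;
  tracking_init_le : forall a x, a \in L -> x \in accepted a -> init a <= x;
  (* Makes the head of a superseding automaton later than the superseded one. *)
  tracking_order : forall a b, a \in L -> b \in L -> init a < init b ->
    exists x p, accepted a = x :: p /\ x < init b;
  tracking_start : exists2 a, a \in L & state a = 0;
  (* Expired embeddings are exempt: the automaton ahead of them may have been
     removed for completing with too large a span. *)
  tracking_latest : forall x p, embedding s k (x :: p) ->
    (forall y, y < k -> etime D y <= etime D x + TX) ->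
    exists2 a, a \in L & exists y q,
      [/\ accepted a = y :: q, x <= y & size p <= size q]
}.

Lemma tracking0 s : tracking s s [:: Automaton s [::]].
Proof.
split.
- by move=> a; rewrite inE => /eqP ->; apply: embedding_nil.
- by move=> a; rewrite inE => /eqP ->.
- by move=> a; rewrite inE => /eqP ->.
- by move=> a x; rewrite inE => /eqP ->.
- by move=> a b; rewrite !inE => /eqP -> /eqP ->; rewrite ltnn.
- by exists (Automaton s [::]); rewrite ?mem_head.
- move=> x p /embedding_mem/(_ (mem_head _ _))/andP[sx xs].
  by rewrite ltnNge sx in xs.
Qed.

(** The crux is [tracking_latest]: an automaton witnessing it stays, moves, or is superseded by one
    that started later and is in the same state. Completion is excluded while the embedding is
    unexpired. *)
Lemma tracking_miss s l c L : s <= l -> tracking s l (automata c) ->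
  miss c l L -> tracking s l.+1 L.
Proof.
move=> sl [emb st ini inile ord start latest] [late Lsub Lacc Lfresh Lkeep].
have wE a : waits alpha (etype D l) a =
    (onth alpha (size (accepted a)) == Some (etype D l)).
  by [].
split.
- move=> a' /Lsub[[/emb/embeddingS//]|[a [ac wa _ ->]]|[_ ->]].
    by rewrite embedding_rcons sl emb.
  exact: embedding_nil.
- move=> a' /Lsub[[/st//]|[a [ac wa sa ->]]|[_ ->//]].
  by rewrite state_accept ltn_neqAle st // andbT; apply/eqP.
- move=> a' /Lsub[[/ini/leqW//]|[a [/ini/leqW ac wa sa ->]]|[_ ->//]] //.
- move=> a' x /Lsub[[/inile le _]|[a [ac wa sa ->]]|[_ ->//]]; first exact: le.
  by rewrite /= mem_rcons inE => /predU1P[->|]; [apply: ini | apply: inile].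
- move=> a' b' /Lsub ha /Lsub hb.
  have init_b : (exists2 b, b \in automata c & init b' = init b) \/
      (exists a, [/\ a \in automata c, waits alpha (etype D l) a
                      & state a = 0]) /\ init b' = l.+1.
    by case: hb => [[bc _]|[b [bc _ _ ->]]|[eb ->]];
      [left; exists b' | left; exists b | right].
  case: ha => [[ac wa]|[a [ac wa sa ->]]|[_ ->]].
  + case: init_b => [[b bc ->]|[[b [bc wb sb]] ->] _]; first exact: ord.
    (* Had [a'] accepted nothing, it would be in state 0 like [b] and would have moved too. *)
    case ea: (accepted a') => [|x p].
      by case/negP: wa; move: wb; rewrite !wE ea -/(state b) sb.
    exists x, p; split=> //.
    by have/(_ x) := embedding_mem (emb _ ac); rewrite ea mem_head;
      move=> /(_ isT)/andP[_ /ltnW].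
  + case: init_b => [[b bc ->] /(ord _ _ ac bc)[x [p [ea xb]]]|[_ ->] _].
      by exists x, (rcons p l); rewrite /= ea.
    case ea: (accepted a) => [|x p]; first by exists l, [::]; rewrite /= ea.
    exists x, (rcons p l); rewrite /= ea; split=> //.
    by have/(_ x) := embedding_mem (emb _ ac); rewrite ea mem_head;
      move=> /(_ isT)/andP[_ /ltnW].
  + case: init_b => [[b /ini bc ->] /= lb|[_ ->]]; last by rewrite ltnn.
    by have := leq_trans lb bc; rewrite ltnNge leqnSn.
- have [a ac sa] := start.
  (* If the automaton in state 0 moves, a fresh one replaces it; otherwise it stays, since
     superseding only concerns positive states. *)
  case: (boolP (waits alpha (etype D l) a)) => wa.
    by exists (Automaton l.+1 [::]); rewrite // (Lfresh a).
  have [aL|[b [_ _ _ sab _]]] := Lkeep a ac wa; first by exists a.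
  by rewrite sa in sab.
- move=> x p exp alive.
  have alive_l y : y < l -> etime D y <= etime D x + TX.
    by move/ltnW; apply: alive.
  (* The Boolean [waits] is added as a number: the successor of [a] is one state further when [a]
     waited for the event. *)
  have keep a y q : a \in automata c -> accepted a = y :: q -> x <= y ->
      exists2 a', a' \in L & exists y' q',
      [/\ accepted a' = y' :: q', x <= y'
        & size q + waits alpha (etype D l) a <= size q'].
    move=> ac ea xy; case: (boolP (waits alpha (etype D l) a)) => wa.
      have [sa|sa] := eqVneq (state a) m; last first.
        exists (accept l a); first by apply: Lacc => //; apply/eqP.
        by exists y, (rcons q l); rewrite /= ea size_rcons addn1.
      (* Completing here would give span at most [TX], because [x <= y] and [x] is unexpired at [l];
         [miss_span] forbids this. *)
      have := late a ac wa sa; rewrite /span tracked_rcons_max // ea /=.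
      rewrite tracked_cons0 ltnNge leq_subLR => /negP[].
      by rewrite (leq_trans (alive l (ltnSn l))) // leq_add2r etime_le.
    have [aL|[b [bc wb sb sab iab]]] := Lkeep a ac wa.
      by exists a => //; exists y, q; rewrite addn0.
    (* The superseding automaton starts after [y]: its first event is [l] itself, or lies at or
       after [init b], which exceeds [y] by [tracking_order]. *)
    exists (accept l b); first by apply: Lacc => // eb; rewrite eb ltnn in sb.
    have [y' [q' [ea' yb]]] := ord _ _ ac bc iab.
    move: ea'; rewrite ea => -[? ?]; subst y' q'.
    move: sab; rewrite /state ea /=; case eb: (accepted b) => [|z r] /= [] eq.
      exists l, [::]; rewrite eq; split=> //.
      rewrite (leq_trans xy) // ltnW //.
      by have/(_ y) := embedding_mem (emb _ ac); rewrite ea mem_head;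
      move=> /(_ isT)/andP[].
    exists z, (rcons r l); split=> //.
      rewrite (leq_trans xy) // (leq_trans (ltnW yb)) // inile // eb.
      exact: mem_head.
    by rewrite eq addn0 size_rcons.
  case: (embeddingSP exp) => [/latest/(_ alive_l)[a ac [y [q [ea xy pq]]]]|].
    have [a' a'L [y' [q' [ea' xy' qq']]]] := keep _ _ _ ac ea xy.
    exists a' => //; exists y', q'; split=> //.
    by rewrite (leq_trans pq) // (leq_trans _ qq') // leq_addr.
  case=> -[|z r] [ezr _ er wr].
    (* The embedding is [l] alone, matched by the automaton in state 0. For [m = 0] that automaton
       would complete with span 0, contradicting [miss_span]. *)
    case: ezr => -> ->; have [a ac sa] := start.
    have ea : accepted a = [::] by apply: size0nil.
    have wa : waits alpha (etype D l) a by rewrite wE ea wr.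
    exists (accept l a); last by exists l, [::]; rewrite /= ea.
    apply: Lacc => //; rewrite sa => m0.
    have := late a ac wa (etrans sa m0).
    by rewrite /span tracked_rcons_max ea // tracked_cons0 subnn.
  case: ezr => ezx ->; rewrite -{}ezx in er.
  have [a ac [y [q [ea xy rq]]]] := latest _ _ er alive_l.
  have [a' a'L [y' [q' [ea' xy' qq']]]] := keep _ _ _ ac ea xy.
  exists a' => //; exists y', q'; split=> //; rewrite size_rcons.
  (* With equal lengths, [a] waits for the very event that extends the embedding and advances with
     it; otherwise [a] was already ahead. *)
  move: rq; rewrite leq_eqVlt => /predU1P[rq|rq]; last first.
    by rewrite (leq_trans rq) // (leq_trans _ qq') // leq_addr.
  by move: wr qq'; rewrite wE ea /= -rq => ->; rewrite eqxx addn1.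
Qed.

(** Without its last event, [h] is an unexpired embedding. The automaton given by [tracking_latest]
    has reached state [m] and started no earlier, so its span at [l] is at most that of [h]. *)
Lemma valid_hit s l h : valid h -> s <= h ord0 -> h ord_max = l ->
  forall c, tracking s l (automata c) ->
  exists2 a, a \in automata c & [/\ waits alpha (etype D l) a, state a = m
    & span D (tracked m l (rcons (accepted a) l)) <= TX].
Proof.
case=> occ_h span_h s_h h_l c [emb st ini inile ord start latest].
have emb_h : embedding s l.+1 (trace h) by apply: embedding_trace; rewrite ?h_l.
have [q [eh size_q]] := traceE h.
move: emb_h; rewrite eh h_l embedding_rcons => /and3P[sl emb_q].
case: q size_q {eh} (eh) emb_q => [|x q] /= size_q eh emb_q wq [h0].
  (* Here [m = 0]: the occurrence is the single event [l], of span 0. *)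
  have [a ac sa] := start; exists a => //; split; first by rewrite /waits sa.
    by rewrite sa.
  have -> : accepted a = [::] by apply: size0nil.
  by rewrite /span tracked_rcons_max // tracked_cons0 subnn.
have alive y : y < l -> etime D y <= etime D x + TX.
  move=> /ltnW yl; rewrite h0 -leq_subLR; apply: leq_trans span_h.
  by rewrite /span leq_sub2r // h_l etime_le.
have [a ac [y [r [ea xy qr]]]] := latest x q emb_q alive.
have sa : state a = m.
  by apply/eqP; rewrite eqn_leq st // /state ea /= -size_q ltnS.
exists a => //; split=> //; first by rewrite /waits (etrans sa (esym size_q)).
rewrite /span tracked_rcons_max // ea /= tracked_cons0.
apply: leq_trans span_h; rewrite /span h_l leq_sub2l // -h0.
by rewrite etime_le.
Qed.

(** * Resets, and counting non-overlapped occurrences *)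

(** [found_maximal] counts only the members starting before the last reset [s]; at [k = n],
    [no_valid] shows that there are no others. *)
Record invariant s k c : Prop := Invariant {
  reset_le : s <= k;
  invariant_tracking : tracking s k (automata c);
  found_valid : forall h, h \in found c -> valid h /\ h ord_max < s;
  found_non_overlapped : pairwise (non_overlapped D) (found c);
  no_valid : forall h, valid h -> s <= h ord0 -> ~~ (h ord_max < k);
  found_maximal : forall H : {set {ffun 'I_m.+1 -> 'I_n}},
    (forall h, h \in H -> valid h) ->
    (forall h1 h2, h1 \in H -> h2 \in H -> h1 != h2 -> non_overlapped D h1 h2) ->
    #|[set h in H | h ord0 < s]| <= size (found c)
}.

Lemma invariant0 : invariant 0 0 (nox_init n m).
Proof.
split=> //=; first exact: tracking0.
move=> H _ _; rewrite leqn0 cards_eq0; apply/eqP/setP=> h.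
by rewrite !inE ltn0 andbF.
Qed.

Lemma occurrence_le h : occurrence D alpha h -> h ord0 <= h ord_max.
Proof.
case=> _ time_h; have [->|ne] := eqVneq (@ord0 m) ord_max; first by [].
by apply: ltnW; rewrite -etime_lt time_h // lt0n eq_sym.
Qed.

(** A counted occurrence moves the reset to [l.+1]; otherwise [s] is unchanged, and [valid_hit]
    excludes a valid occurrence ending at [l]. *)
Lemma invariant_step s l c : invariant s l c ->
  exists s', invariant s' l.+1 (nox_step D alpha TX c l).
Proof.
case=> sl tr fv fno nv fmax.
have spec := nox_stepP c l.
case eq_c': _ / (spec) => [a ac wa sa sp|L ms].
  exists l.+1; split=> //=; first exact: tracking0.
  - move=> h; rewrite mem_rcons inE => /predU1P[->|/fv[vh hs]]; last first.
      by split=> //; rewrite (leq_trans hs) // leqW.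
    split; last by rewrite tracked_rcons_max.
    split=> //; apply: (@tracked_occurrence s l.+1).
      by rewrite embedding_rcons sl (tracking_embedding tr).
    by rewrite size_rcons -/(state a) sa.
  - rewrite pairwise_rcons fno andbT; apply/allP=> h /fv[_ hs].
    (* Earlier counted occurrences end before [s], and the new one starts at or after [s]. *)
    rewrite /non_overlapped !etime_lt; apply/orP; left.
    apply: leq_trans hs _.
    have := tracking_embedding tr ac; rewrite ffunE.
    case ea: (accepted a) => [|x q] //= /embedding_mem/(_ (mem_head _ _)).
    by case/andP.
  - move=> h [occ_h _] lh; rewrite -leqNgt.
    exact: leq_trans lh (occurrence_le occ_h).
  - move=> H vH noH; rewrite size_rcons.
    set S := [set h in H | s <= h ord0 < l.+1].
    (* Of two members of [S], one would end before the other starts, hence before [l], against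
       [no_valid]. *)
    have : #|S| <= 1.
      apply/card_le1_eqP=> h1 h2; rewrite !inE.
      case/and3P=> h1H sh1 h1l /and3P[h2H sh2 h2l].
      apply/eqP; apply: contraT => ne12.
      have := noH _ _ h2H h1H ne12; rewrite /non_overlapped !etime_lt.
      case/orP=> [lt|lt].
        by have := nv _ (vH _ h2H) sh2; rewrite (leq_trans lt).
      by have := nv _ (vH _ h1H) sh1; rewrite (leq_trans lt).
    rewrite -(addn1 (size _)) => S1.
    apply: leq_trans (leq_add (fmax H vH noH) S1).
    apply: leq_trans (leq_card_setU _ _); apply: subset_leq_card.
    apply/subsetP=> h; rewrite !inE => /andP[-> ->] /=.
    by rewrite andbT ltnNge orNb.
exists s; split=> //=; first exact: leqW.
  exact: tracking_miss tr ms.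
move=> h vh sh; rewrite ltnS leq_eqVlt negb_or nv // andbT.
apply/eqP=> /val_inj hl.
have [a ac [wa sa]] := valid_hit vh sh hl tr.
by rewrite leqNgt (miss_span ms).
Qed.

Lemma invariant_nox : exists s,
  invariant s n (foldl (nox_step D alpha TX) (nox_init n m) (enum 'I_n)).
Proof.
suff inv k : k <= n -> exists s, invariant s k
    (foldl (nox_step D alpha TX) (nox_init n m) (take k (enum 'I_n))).
  by have := inv n (leqnn n); rewrite take_oversize // size_enum_ord.
elim: k => [|k IHk] lt_kn; first by exists 0; rewrite take0; apply: invariant0.
(* The default value is chosen to be the element of index [k] itself. *)
rewrite (take_nth (Ordinal lt_kn)) ?size_enum_ord // foldl_rcons.
rewrite (nth_ord_enum _ (Ordinal lt_kn)).
have [s] := IHk (ltnW lt_kn).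
exact: (@invariant_step s (Ordinal lt_kn)).
Qed.

End NoX.

Theorem theorem1 (A : finType) (n m : nat) (D : n.-tuple (A * nat))
    (alpha : m.+1.-tuple A) (TX : nat)
    (t_pos : forall i : 'I_n, 0 < etime D i)
    (t_incr : forall i j : 'I_n, i < j -> etime D i < etime D j) :
  [/\ forall h, h \in nox D alpha TX -> occurrence D alpha h /\ span D h <= TX,
      pairwise (non_overlapped D) (nox D alpha TX)
    & forall H' : {set {ffun 'I_m.+1 -> 'I_n}},
        (forall h, h \in H' -> occurrence D alpha h /\ span D h <= TX) ->
        (forall h1 h2, h1 \in H' -> h2 \in H' -> h1 != h2 ->
           non_overlapped D h1 h2) ->
        #|H'| <= size (nox D alpha TX)].
Proof.
have [s [sn tr fv fno nv fmax]] := invariant_nox alpha TX t_incr.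
split=> // [h /fv[]//|H vH noH].
(* All of [H] starts before [s]: a member starting later would have to end at position [n] or
   beyond. *)
apply: leq_trans (fmax H vH noH); apply: subset_leq_card.
apply/subsetP=> h hH; rewrite inE hH ltnNge.
by apply/negP=> /(nv _ (vH h hH)); rewrite ltn_ord.
Qed.
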